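(* Let $f:\mathbb{R}^d\to[0,\infty)$ be Lipschitz continuous with Lipschitz constant $L_f>0$, let the random process $\{x^{i,k}\}_{i=1}^N$, $k\ge0$, be generated by the ESCBO algorithm, and assume that $$(1-\lambda)^2+\delta^2<\frac12\quad\text{and}\quad \lim_{k\to\infty}\alpha_k=0.$$ Then $\{x^{i,k}\}_{i=1}^N$ admits almost sure global consensus in an exponential rate, i.e. there exists a constant $\tau_2>0$ such that $$\lim_{k\to\infty}\mathrm{e}^{\tau_2 k}\|x^{i,k}-x^{j,k}\|^2=0\quad\text{almost surely, for all } i,j\in[N].$$
   Context: $[N]=\{1,\dots,N\}$; $\|\cdot\|$ is the Euclidean norm; $\odot$ is the componentwise (Hadamard) product; $e_l$ is the $l$-th column of the identity matrix. Forward-difference gradient estimator with interval $\sigma>0$: $g(x)\in\mathbb{R}^d$ with $[g(x)]_l=\frac{f(x+\sigma e_l)-f(x)}{\sigma}$, $l\in[d]$. ESCBO algorithm: given $N$, initial points $x^{i,0}\in\mathbb{R}^d$ ($i\in[N]$), parameters $\beta>0$, $\lambda>0$, $\delta\ge0$, $\sigma>0$ and a nonnegative sequence $\{\alpha_k\}_{k\ge0}$, for $k=0,1,2,\dots$ set $$\bar x^{\star,k}=\frac{\sum_{i=1}^N x^{i,k}\mathrm{e}^{-\beta f(x^{i,k})}}{\sum_{i=1}^N \mathrm{e}^{-\beta f(x^{i,k})}},$$ draw a random vector $\eta^k=(\eta^k_1,\dots,\eta^k_d)^\top$ with i.i.d. components $\eta^k_l\sim\mathcal{N}(0,\delta^2)$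 (the same $\eta^k$ is used for all particles; the vectors $\eta^0,\eta^1,\dots$ are mutually independent), and for every $i\in[N]$ set $$y^{i,k+1}=x^{i,k}-\lambda(x^{i,k}-\bar x^{\star,k})-(x^{i,k}-\bar x^{\star,k})\odot\eta^k,\qquad x^{i,k+1}=y^{i,k+1}-\alpha_k\,g(x^{i,k}).$$ *)

(* Defs.v *)
From HB Require Import structures.
From mathcomp Require Export all_boot all_order all_algebra.
From mathcomp Require Export all_classical all_reals all_analysis.
Export Order.TTheory GRing.Theory Num.Theory.
Export numFieldNormedType.Exports.

Set Implicit Arguments.
Unset Strict Implicit.
Unset Printing Implicit Defensive.

Local Open Scope classical_set_scope.
Local Open Scope ring_scope.

Section euclidean.
Context {R : realType} {d : nat}.
Implicit Types (x y : 'cV[R]_d) (f : 'cV[R]_d -> R).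

(* The library norm on matrices is the sup norm, hence the explicit Euclidean
   norm and Lipschitz condition below. *)
Definition eucl_norm x : R := Num.sqrt (\sum_(l < d) x l 0 ^+ 2).

Definition eucl_lipschitz (L : R) f :=
  forall x y, `|f x - f y| <= L * eucl_norm (x - y).

Definition hadamard x y : 'cV[R]_d := map2_mx *%R x y.

Definition fd_grad (sigma : R) f x : 'cV[R]_d :=
  \col_(l < d) ((f (x + sigma *: col l 1%:M) - f x) / sigma).

End euclidean.

Section algorithm.
Context {R : realType} {d N : nat}.
Variables (f : 'cV[R]_d -> R) (beta lambda sigma : R) (alpha : nat -> R).

Definition consensus_point (x : 'I_N -> 'cV[R]_d) : 'cV[R]_d :=
  (\sum_(i < N) expR (- beta * f (x i)))^-1 *:
    \sum_(i < N) expR (- beta * f (x i)) *: x i.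

(* The noise [w] does not depend on the particle. *)
Definition escbo_step (a : R) (w : 'cV[R]_d) (x : 'I_N -> 'cV[R]_d) (i : 'I_N) :
    'cV[R]_d :=
  let xstar := consensus_point x in
  let y := x i - lambda *: (x i - xstar) - hadamard (x i - xstar) w in
  y - a *: fd_grad sigma f (x i).

(* [escbo x0 eta k i] is the [i]-th particle after [k] steps, from the initial
   points [x0] and along the noise path [eta]. *)
Fixpoint escbo (x0 : 'I_N -> 'cV[R]_d) (eta : nat -> 'cV[R]_d) (k : nat) :
    'I_N -> 'cV[R]_d :=
  if k is k'.+1 then escbo_step (alpha k') (eta k') (escbo x0 eta k') else x0.

End algorithm.

(* [normal_law m s] is N(m, s^2). The library's [normal_prob m 0] is the uniform
   law on [0, 1], so that the degenerate case has to be treated separately. *)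
Definition normal_law {R : realType} (m s : R) : set R -> \bar R :=
  if s == 0 then dirac m else normal_prob m s.

Section independence.
Context {disp : measure_display} {T : measurableType disp} {R : realType}.
Variable P : probability T R.

(* Mutual independence of a family of systems of events. *)
Definition mutually_independent (I : eqType) (F : I -> set (set T)) :=
  forall (s : seq I) (A : I -> set T), uniq s ->
    (forall i, i \in s -> F i (A i)) ->
    P (\big[setI/setT]_(i <- s) A i) = (\prod_(i <- s) P (A i))%E.

(* [eta k l] is the [l]-th component of the [k]-th noise vector;
   [g_sigma_preimage (eta k)] is the sigma-algebra generated by that vector. *)
Definition escbo_noise (d : nat) (delta : R)
    (eta : nat -> 'I_d -> {RV P >-> R}) :=
  [/\ forall k l (B : set R), measurable B ->
        distribution P (eta k l) B = normal_law 0 delta B,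
      forall k, mutually_independent
        (fun l => preimage_set_system setT (eta k l) measurable) &
      mutually_independent (fun k => g_sigma_preimage (eta k))].

End independence.

(* Main.v *)
Require Import Defs.
From mathcomp Require Import all_boot all_order all_algebra.
From mathcomp Require Import all_classical all_reals all_analysis.
From mathcomp Require Import measurable_realfun ring lra.
Import Order.TTheory GRing.Theory Num.Theory.
Import numFieldNormedType.Exports.

(* Write D for the difference of two particles; c = 2 Lf / sigma is a Lipschitz
   constant of each coordinate of the gradient estimator. The consensus point
   cancels in D, and (p - q)^2 <= 2 p^2 + 2 q^2 gives, coordinatewise,
     D_l(k+1)^2 <= 2 (1 - lambda - eta_l)^2 D_l(k)^2 + 2 (alpha_k c)^2 |D(k)|^2.
   Replacing <= with = yields a majorant that no longer involves f and is
   polynomial in the noise; each of its terms involves a single coordinate of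
   eta_k, so that independence across k gives a closed recursion for its
   expectations. Their sum over l is eventually contracted by any factor
   rho > 2 ((1 - lambda)^2 + delta^2). For rho = exp(- 2 tau) < 1 the
   expectations of exp(tau k) |D(k)|^2 are summable, so these variables are
   almost surely summable. *)

Set Implicit Arguments.
Unset Strict Implicit.
Unset Printing Implicit Defensive.

Local Open Scope classical_set_scope.
Local Open Scope ring_scope.

(** * Integrals against the image of a weighted measure *)

Section density.
Local Open Scope ereal_scope.
Context d d' (T : measurableType d) (T' : measurableType d') (R : realType).
Variables (mu : {measure set T -> \bar R}) (nu : {measure set T' -> \bar R}).
Variables (X : T -> T') (Z : T -> R).
Hypotheses (mX : measurable_fun setT X) (mZ : measurable_fun setT Z).
Hypothesis Z_ge0 : forall w, (0 <= Z w)%R.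
Hypothesis nuE : forall B, measurable B ->
  \int[mu]_(w in X @^-1` B) (Z w)%:E = nu B.

Import HBNNSimple.

Let integral_density_nnsfun (h : {nnsfun T' >-> R}) :
  \int[nu]_y (h y)%:E = \int[mu]_w ((h (X w))%:E * (Z w)%:E).
Proof.
under eq_integral do rewrite fimfunE -fsumEFin//.
rewrite ge0_integral_fsum//; last 2 first.
- by move=> y; exact/measurable_EFinP/measurable_funM.
- by move=> y x _; rewrite nnfun_muleindic_ge0.
under [RHS]eq_integral => w _.
  rewrite fimfunE -fsumEFin// ge0_mule_fsuml; last first.
    by move=> r; rewrite nnfun_muleindic_ge0.
  over.
rewrite ge0_integral_fsum//; last 2 first.
- move=> r; apply: emeasurable_funM; last exact/measurable_EFinP.
  apply/measurable_EFinP/measurable_funM => //.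
  by apply: (measurableT_comp _ mX); exact: measurable_indic.
- by move=> r w _; rewrite mule_ge0 ?nnfun_muleindic_ge0 ?lee_fin.
apply: eq_fsbigr => r _.
rewrite integralZl_indic_nnsfun// integral_indic// setIT -nuE//.
have [r0|r0] := ltP r 0%R.
  rewrite preimage_nnfun0// preimage_set0 integral_set0 mule0.
  by rewrite integral0_eq// => w _; rewrite indicE in_set0 mulr0 mul0e.
under [RHS]eq_integral do rewrite EFinM -muleA.
rewrite ge0_integralZl_EFin//; last 2 first.
- by move=> w _; rewrite mule_ge0// lee_fin.
- apply: emeasurable_funM; last exact/measurable_EFinP.
  apply/measurable_EFinP.
  by apply: (measurableT_comp _ mX); exact: measurable_indic.
congr (_ * _); rewrite integral_mkcond; apply: eq_integral => w _.
by rewrite epatch_indic/= muleC.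
Qed.

(** Under [nuE], [nu] is the image under [X] of the measure with density [Z] with respect to [mu].
    The formula holds for simple functions and passes to the limit by monotone convergence. It
    serves both for Gaussian densities ([X] the identity) and for factoring expectations of
    independent quantities. *)
Lemma ge0_integral_density (h : T' -> \bar R) :
  measurable_fun setT h -> (forall y, 0 <= h y) ->
  \int[nu]_y h y = \int[mu]_w (h (X w) * (Z w)%:E).
Proof.
move=> mh h0; pose h_ := nnsfun_approx measurableT mh.
have h_cvg y : (h_ n y)%:E @[n --> \oo] --> h y.
  by apply: cvg_nnsfun_approx => // z _; exact: h0.
transitivity (limn (fun n => \int[nu]_y (h_ n y)%:E)).
  rewrite -monotone_convergence//.
  - by apply: eq_integral => y _; apply/esym/cvg_lim.
  - by move=> n; exact/measurable_EFinP/measurable_funP.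
  - by move=> n y _; rewrite lee_fin.
  - by move=> y _ m n mn; rewrite lee_fin; exact/lefP/nd_nnsfun_approx.
under eq_fun do rewrite integral_density_nnsfun.
rewrite -monotone_convergence//.
- apply: eq_integral => w _; apply/cvg_lim => //.
  by apply: cvgeZr.
- move=> n; apply: emeasurable_funM; last exact/measurable_EFinP.
  by apply/measurable_EFinP; apply: measurableT_comp mX.
- by move=> n w _; rewrite mule_ge0// lee_fin.
- move=> w _ m n mn; rewrite lee_wpmul2r ?lee_fin//.
  exact/lefP/nd_nnsfun_approx.
Qed.

End density.

(** * The second moment of a Gaussian law about a point [a] *)

Section normal_second_moment.
Context {R : realType}.
Variables (a s : R).
Hypothesis s_gt0 : 0 < s.

(* The factor on the left is [1 + t (a - x)^2] with [t = (1 - k^-2) / (2 s^2)].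
   It is at most [expR (t (a - x)^2)], whose product with a centered Gaussian
   density is again, up to a constant, a Gaussian density. The bound on the
   second moment then follows from the normalization of Gaussian densities by
   letting [k] tend to 1. *)
Lemma normal_pdf_tilt_le (k x : R) : 1 <= k ->
  (1 + (1 - k ^- 2) / (s ^+ 2 *+ 2) * (a - x) ^+ 2) * normal_pdf 0 s x <=
  expR ((k ^+ 2 - 1) / (s ^+ 2 *+ 2) * (a ^+ 2 + s ^+ 2)) *
    normal_pdf (- a * (k ^+ 2 - 1)) (s * k) x.
Proof.
move=> k1; have k0 : 0 < k by rewrite (lt_le_trans _ k1).
have sN0 : s != 0 by rewrite gt_eqF.
have kN0 : k != 0 by rewrite gt_eqF.
have peakE : normal_peak s = k * normal_peak (s * k).
  rewrite /normal_peak [in RHS](_ : _ *+ 2 = k ^+ 2 * (s ^+ 2 * pi *+ 2));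
    last by ring.
  by rewrite sqrtrM ?sqr_ge0// sqrtr_sqr gtr0_norm// invfM mulVKf.
rewrite !normal_pdfE ?mulf_neq0// peakE /normal_fun.
(* Here [y] equals [(k ^+ 2 - 1) / 2], and [k <= expR y] follows by squaring from [1 + z <= expR z]
   at [z = k ^+ 2 - 1]. This absorbs the ratio [k] of the two normalizing constants. *)
set y := (k ^+ 2 - 1) / (s ^+ 2 *+ 2) * s ^+ 2.
have k_le : k <= expR y.
  rewrite -(@ler_pXn2r _ 2)// ?nnegrE ?expR_ge0 ?(ltW k0)// -expRM_natl.
  apply: (le_trans _ (expR_ge1Dx _)).
  rewrite le_eqVlt; apply/orP; left; apply/eqP.
  by rewrite /y; field.
have -> : expR ((k ^+ 2 - 1) / (s ^+ 2 *+ 2) * (a ^+ 2 + s ^+ 2)) =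
    expR y * expR ((k ^+ 2 - 1) / (s ^+ 2 *+ 2) * a ^+ 2).
  by rewrite -expRD /y; congr expR; ring.
rewrite [leLHS](_ : _ = normal_peak (s * k) * (k *
    ((1 + (1 - k ^- 2) / (s ^+ 2 *+ 2) * (a - x) ^+ 2) *
      expR (- (x - 0) ^+ 2 / (s ^+ 2 *+ 2))))); last by ring.
rewrite [leRHS](_ : _ = normal_peak (s * k) * (expR y *
    (expR ((k ^+ 2 - 1) / (s ^+ 2 *+ 2) * a ^+ 2) *
      expR (- (x - - a * (k ^+ 2 - 1)) ^+ 2 / ((s * k) ^+ 2 *+ 2)))));
  last by ring.
have t_ge0 : 0 <= (1 - k ^- 2) / (s ^+ 2 *+ 2).
  rewrite divr_ge0 ?mulrn_wge0 ?sqr_ge0// subr_ge0 invf_le1 ?exprn_gt0//.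
  exact: exprn_ege1.
rewrite ler_wpM2l ?normal_peak_ge0// ler_pM// ?(ltW k0)//.
  by rewrite mulr_ge0 ?expR_ge0// addr_ge0// mulr_ge0// sqr_ge0.
rewrite (le_trans (ler_wpM2r (expR_ge0 _) (expR_ge1Dx _)))// -!expRD ler_expR.
by rewrite le_eqVlt; apply/orP; left; apply/eqP; field; rewrite sN0 kN0.
Qed.

Let V := a ^+ 2 + s ^+ 2.

Let V_gt0 : 0 < V.
Proof. by rewrite ltr_wpDl ?sqr_ge0// exprn_gt0. Qed.

Local Open Scope ereal_scope.

Let measurable_sqr : measurable_fun [set: R] (fun x => (a - x) ^+ 2)%R.
Proof. by apply: measurable_funX; exact: measurable_funB. Qed.

(** The law is fixed only through its values on measurable sets, which is what the hypothesis on a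
    noise coordinate provides. *)
Variable nu : {measure set R -> \bar R}.
Hypothesis nuE : forall B : set R, measurable B -> nu B = normal_prob 0%R s B.

Lemma integral_normal_law_tilt_le (k : R) : (1 <= k)%R ->
  \int[nu]_x
    (1 + (1 - k ^- 2) / (s ^+ 2 *+ 2) * (a - x) ^+ 2)%:E <=
  (expR ((k ^+ 2 - 1) / (s ^+ 2 *+ 2) * V))%:E.
Proof.
move=> k1; have k0 : (0 < k)%R by rewrite (lt_le_trans _ k1).
have t_ge0 : (0 <= (1 - k ^- 2) / (s ^+ 2 *+ 2))%R.
  rewrite divr_ge0 ?mulrn_wge0 ?sqr_ge0// subr_ge0 invf_le1 ?exprn_gt0//.
  exact: exprn_ege1.
have mf : measurable_fun [set: R]
   (fun x => 1 + (1 - k ^- 2) / (s ^+ 2 *+ 2) * (a - x) ^+ 2)%R.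
  by apply: measurable_funD => //; exact: measurable_funM.
rewrite (@ge0_integral_density _ _ _ _ _ lebesgue_measure _
    (id : measurableTypeR R -> R) (normal_pdf 0 s))//; last 5 first.
- exact: measurable_normal_pdf.
- by move=> x; exact: normal_pdf_ge0.
- by move=> B mB; rewrite nuE.
- exact/measurable_EFinP.
- by move=> x; rewrite lee_fin addr_ge0// mulr_ge0// sqr_ge0.
rewrite -[leRHS]mule1 -(integral_normal_pdf (- a * (k ^+ 2 - 1)) (s * k)).
rewrite -ge0_integralZl_EFin ?expR_ge0//; last 2 first.
- by move=> x _; rewrite lee_fin normal_pdf_ge0.
- by apply/measurable_EFinP; exact: measurable_normal_pdf.
apply: ge0_le_integral => //.
- move=> x _; rewrite -EFinM lee_fin mulr_ge0 ?normal_pdf_ge0//.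
  by rewrite addr_ge0// mulr_ge0// sqr_ge0.
- apply/measurable_EFinP/measurable_funM => //; exact: measurable_normal_pdf.
- apply/measurable_EFinP/measurable_funM => //; exact: measurable_normal_pdf.
- by move=> x _; rewrite -!EFinM lee_fin normal_pdf_tilt_le.
Qed.

Lemma integral_normal_law_second_moment_le :
  \int[nu]_x ((a - x) ^+ 2)%:E <= (a ^+ 2 + s ^+ 2)%:E.
Proof.
rewrite -/V; apply/lee_addgt0Pr => e e0.
have s2_gt0 : (0 < s ^+ 2 *+ 2)%R by rewrite mulrn_wgt0// exprn_gt0.
have Ve_gt0 : (0 < V + e)%R by exact: addr_gt0.
have W0 : (0 < V + (V + e) * V / (s ^+ 2 *+ 2))%R.
  by apply: addr_gt0 => //; apply: divr_gt0 => //; exact: mulr_gt0.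
(* Write [I] for the second moment. The tilted bound at [k ^+ 2 = 1 + u] reads
   [1 + t * I <= expR y], and [expR y <= (1 - y)^-1] for [y < 1]. Since [y = t * (1 + u) * V], this
   yields [I <= (1 + u) * V / (1 - y)]. The value of [u] solves the linear equation making this
   bound equal to [V + e]. *)
pose u := (e / (V + (V + e) * V / (s ^+ 2 *+ 2)))%R.
have u0 : (0 < u)%R by rewrite divr_gt0.
pose k := Num.sqrt (1 + u).
have k2 : (k ^+ 2 = 1 + u)%R by rewrite sqr_sqrtr// ltW// addr_gt0.
have k1 : (1 <= k)%R by rewrite -[leLHS]sqrtr1 ler_wsqrtr// lerDl ltW.
pose t := ((1 - k ^- 2) / (s ^+ 2 *+ 2))%R.
pose y := (u / (s ^+ 2 *+ 2) * V)%R.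
have u1_gt0 : (0 < 1 + u)%R by rewrite addr_gt0.
have tE : (t * (1 + u) = u / (s ^+ 2 *+ 2))%R.
  by rewrite /t k2; field; rewrite !gt_eqF.
have t0 : (0 < t)%R by rewrite -(pmulr_lgt0 _ u1_gt0) tE divr_gt0.
have yP : ((1 + u) * V = (V + e) * (1 - y))%R.
  have : (u * (V + (V + e) * V / (s ^+ 2 *+ 2)) = e)%R by rewrite divfK ?gt_eqF.
  by rewrite /y; lra.
have y_lt1 : (y < 1)%R.
  by rewrite -subr_gt0 -(pmulr_rgt0 _ Ve_gt0) -yP mulr_gt0.
have := integral_normal_law_tilt_le k1.
rewrite -/t k2 [(1 + u - 1)%R]addrC addKr -/y => int_le.
have mq : measurable_fun [set: R] (fun x => ((a - x) ^+ 2)%:E).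
  exact/measurable_EFinP.
have q0 x : 0 <= ((a - x) ^+ 2)%:E :> \bar R by rewrite lee_fin sqr_ge0.
have : 1 + t%:E * \int[nu]_x ((a - x) ^+ 2)%:E <= ((1 - y)^-1)%:E.
  apply: (@le_trans _ _ (expR y)%:E); last first.
    rewrite lee_fin -[expR y]invrK -expRN lef_pV2 ?posrE ?subr_gt0 ?expR_gt0//.
    exact: expR_ge1Dx.
  apply: le_trans int_le; rewrite le_eqVlt; apply/orP; left; apply/eqP.
  under [RHS]eq_integral do rewrite EFinD EFinM.
  rewrite ge0_integralD//; last 2 first.
  - by move=> x _; rewrite mule_ge0// lee_fin ltW.
  - exact: measurable_funeM.
  rewrite ge0_integralZl_EFin ?(ltW t0)// integral_cst//.
  by congr (_ + _); rewrite mul1e nuE// /normal_prob integral_normal_pdf.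
have : 0 <= \int[nu]_x ((a - x) ^+ 2)%:E by exact: integral_ge0.
case: (\int[nu]_x _) => [r| |]//=; last first.
  by rewrite gt0_muley ?lte_fin// addey// leye_eq.
rewrite !lee_fin => r0 tr.
rewrite -(ler_pM2l t0); apply: (@le_trans _ _ ((1 - y)^-1 - 1)%R).
  by rewrite lerBrDl.
have y1 : (1 - y != 0)%R by rewrite subr_eq0 gt_eqF.
rewrite -(ler_pM2r (_ : 0 < 1 - y)%R) ?subr_gt0// mulrBl mulVf// mul1r subKr.
by rewrite -mulrA -yP mulrA tE -/y.
Qed.

End normal_second_moment.

Lemma normal_law_second_moment_le (R : realType) (disp : measure_display)
    (T : measurableType disp) (P : probability T R) (X : {RV P >-> R})
    (a s : R) :
  0 <= s ->
  (forall B : set R, measurable B ->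
    distribution P X B = normal_law 0 s B) ->
  (\int[P]_w ((a - X w) ^+ 2)%:E <= (a ^+ 2 + s ^+ 2)%:E)%E.
Proof.
move=> s_ge0 XE.
have mq : measurable_fun [set: R] (fun x => ((a - x) ^+ 2)%:E).
  by apply/measurable_EFinP; apply: measurable_funX; exact: measurable_funB.
rewrite -[leLHS](@ge0_integral_distribution _ _ _ _ _ P X
  (fun x => ((a - x) ^+ 2)%:E))//; last by move=> x; rewrite lee_fin sqr_ge0.
(* For [s = 0] the law is the Dirac mass at 0 and the bound is an equality. *)
have [s0|s_neq0] := eqVneq s 0.
  rewrite (eq_measure_integral (dirac (0 : R))); last first.
    by move=> B mB _; apply: etrans (XE B mB) _; rewrite /normal_law s0 eqxx.
  by rewrite integral_dirac// diracT mul1e subr0 s0 expr0n addr0.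
apply: integral_normal_law_second_moment_le; first by rewrite lt_def s_neq0.
by move=> B mB; apply: etrans (XE B mB) _; rewrite /normal_law (negbTE s_neq0).
Qed.

(** * The majorant recursion and its expectation *)

(** The majorant for the squared coordinates of a particle difference. It is run with coefficients
    [b] read off a noise path, and with the expectations of these coefficients. *)
Fixpoint coupled_rec (R : pzRingType) (d : nat) (b : nat -> 'I_d -> R)
    (c : nat -> R) (u0 : 'I_d -> R) (k : nat) : 'I_d -> R :=
  if k is k'.+1 then
    fun l => b k' l * coupled_rec b c u0 k' l +
             c k' * \sum_(m < d) coupled_rec b c u0 k' m
  else u0.

Lemma coupled_rec_ge0 (R : numDomainType) (d : nat) (b : nat -> 'I_d -> R)
    (c : nat -> R) (u0 : 'I_d -> R) :
  (forall k l, 0 <= b k l) -> (forall k, 0 <= c k) -> (forall l, 0 <= u0 l) ->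
  forall k l, 0 <= coupled_rec b c u0 k l.
Proof.
move=> b0 c0 u00; elim=> //= k ih l.
by rewrite addr_ge0 ?mulr_ge0// sumr_ge0.
Qed.

Lemma g_sigma_preimage_measurable (disp disp' : measure_display)
    (T : measurableType disp) (T' : measurableType disp') (n : nat)
    (X : 'I_n -> {mfun T >-> T'}) (A : set T) :
  g_sigma_preimage X A -> measurable A.
Proof.
apply: smallest_sub; first exact: sigma_algebra_measurable.
move=> B; rewrite -bigcup_seq => -[i _ [C mC <-]].
exact: measurable_funP.
Qed.

Lemma g_sigma_preimage_coord (disp disp' : measure_display)
    (T : measurableType disp) (T' : measurableType disp') (n : nat)
    (X : 'I_n -> {mfun T >-> T'}) (l : 'I_n) (B : set T') :
  measurable B -> g_sigma_preimage X (X l @^-1` B).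
Proof.
move=> mB; apply: sub_sigma_algebra; rewrite -bigcup_seq.
by exists l => /=; [rewrite mem_index_enum|exists B => //; rewrite setTI].
Qed.

Section coupled_moments.
Context (disp : measure_display) (T : measurableType disp) (R : realType).
Variables (P : probability T R) (d : nat) (X : nat -> 'I_d -> {RV P >-> R}).
Variables (h : R -> R) (v : nat -> 'I_d -> R) (c : nat -> R) (u0 : 'I_d -> R).
Hypotheses (mh : measurable_fun setT h) (h_ge0 : forall x, 0 <= h x).
Hypotheses (c_ge0 : forall k, 0 <= c k) (u0_ge0 : forall l, 0 <= u0 l).
Hypothesis vE : forall k l, (\int[P]_w (h (X k l w))%:E = (v k l)%:E)%E.
Hypothesis X_indep : mutually_independent P (fun k => g_sigma_preimage (X k)).

Let U k l w := coupled_rec (fun j m => h (X j m w)) c u0 k l.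
Let u := coupled_rec v c u0.

Let U_ge0 k l w : 0 <= U k l w.
Proof. exact: coupled_rec_ge0. Qed.

Let v_ge0 k l : 0 <= v k l.
Proof.
by rewrite -lee_fin -vE; apply: integral_ge0 => w _; rewrite lee_fin.
Qed.

Let u_ge0 k l : 0 <= u k l.
Proof. exact: coupled_rec_ge0. Qed.

Let mhX k l : measurable_fun setT (fun w => h (X k l w)).
Proof. by apply: (measurableT_comp mh); exact: measurable_funP. Qed.

Lemma measurable_coupled_rec k l : measurable_fun setT (U k l).
Proof.
elim: k l => [|k ih] l; first exact: measurable_cst.
apply: measurable_funD.
  by apply: measurable_funM; [exact: mhX|exact: ih].
by apply: measurable_funM => //; apply: measurable_sum => m; exact: ih.
Qed.

(* The state at time [k] only depends on the noise before [k], which is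
   expressed by testing against events generated by the noise from [k] on. *)
Lemma integral_coupled_rec (k : nat) (l : 'I_d) (s : seq nat)
    (A : nat -> set T) :
  uniq s -> (forall t, t \in s -> (k <= t)%N) ->
  (forall t, t \in s -> g_sigma_preimage (X t) (A t)) ->
  (\int[P]_(w in \big[setI/setT]_(t <- s) A t) (U k l w)%:E =
   (u k l)%:E * P (\big[setI/setT]_(t <- s) A t))%E.
Proof.
elim: k l s A => [|k ih] l s A us ks sA.
  rewrite -[RHS]integral_cst//.
  rewrite big_seq; apply: bigsetI_measurable => t ts.
  exact: g_sigma_preimage_measurable (sA _ ts).
set E := \big[setI/setT]_(t <- s) A t.
have mE : measurable E.
  rewrite /E big_seq; apply: bigsetI_measurable => t ts.
  exact: g_sigma_preimage_measurable (sA _ ts).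
have ihE m : (\int[P]_(w in E) (U k m w)%:E = (u k m)%:E * P E)%E.
  by apply: ih => // t /ks /ltnW.
have mU m : measurable_fun E (EFin \o U k m).
  apply/measurable_funTS/measurable_EFinP; exact: measurable_coupled_rec.
have PE_fin : P E \is a fin_num by exact: fin_num_measure.
have step : (\int[P]_(w in E) ((h (X k l w))%:E * (U k l w)%:E) =
    (v k l)%:E * (u k l)%:E * P E)%E.
  have r_ge0 : 0 <= u k l * fine (P E) by rewrite mulr_ge0 ?fine_ge0.
  (* Weighting [P] by the state on [E] and taking the image under [X k l] gives a multiple of the
     law of [X k l]: this is the independence of state and fresh noise, in measure form. Integrating
     [h] against it then factors the expectation. *)
  pose nu := mscale (NngNum r_ge0) (distribution P (X k l)).
  transitivity (\int[nu]_y (h y)%:E)%E; last first.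
    rewrite ge0_integral_mscale//; last 2 first.
    - exact/measurable_EFinP.
    - by move=> y _; rewrite lee_fin.
    rewrite ge0_integral_distribution//; last exact/measurable_EFinP.
    rewrite /= vE muleC EFinM fineK// muleA//.
  rewrite (@ge0_integral_density _ _ _ _ _ P _ (X k l)
    (fun w => \1_E w * U k l w))//.
  - rewrite [LHS]integral_mkcond; apply: eq_integral => w _.
    by rewrite epatch_indic/= !EFinM muleAC muleA.
  - apply: measurable_funM; first exact: measurable_indic.
    exact: measurable_coupled_rec.
  - by move=> w; rewrite mulr_ge0.
  - move=> B mB.
    have -> : (\int[P]_(w in X k l @^-1` B) (\1_E w * U k l w)%:E =
        \int[P]_(w in X k l @^-1` B `&` E) (U k l w)%:E)%E.
      rewrite integral_mkcondr; apply: eq_integral => w _.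
      by rewrite epatch_indic/= muleC EFinM.
    (* All indices in [s] exceed [k], so the event about [X k l] can join the family at the new
       index [k]. The induction hypothesis applies to [k :: s], whose indices are at least [k], and
       independence splits off the probability of the added event. *)
    have ks' : k \notin s by apply/negP => /ks; rewrite ltnn.
    pose A' t := if t == k then X k l @^-1` B else A t.
    have A'E : \big[setI/setT]_(t <- s) A' t = E.
      apply: eq_big_seq => t ts; rewrite /A'; case: eqP => // tk.
      by rewrite -tk ts in ks'.
    have A'kE : X k l @^-1` B `&` E = \big[setI/setT]_(t <- k :: s) A' t.
      by rewrite big_cons A'E /A' eqxx.
    have A'P t : t \in k :: s -> g_sigma_preimage (X t) (A' t).
      rewrite inE /A'; case: eqP => [->|_ /= /sA//] _.
      exact: g_sigma_preimage_coord.
    rewrite A'kE ih ?cons_uniq ?ks'//; last first.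
      by move=> t; rewrite inE => /orP[/eqP->//|/ks/ltnW].
    rewrite X_indep ?cons_uniq ?ks'// big_cons.
    have <- : (P E = \prod_(i <- s) P (A' i))%E.
      rewrite -A'E X_indep// => t ts; apply: A'P.
      by rewrite inE ts orbT.
    rewrite {1}/A' eqxx /nu/= /mscale/= EFinM fineK//.
    rewrite /distribution/= /pushforward.
    by rewrite -muleA; congr (_ * _)%E; rewrite muleC.
  - exact/measurable_EFinP.
transitivity (\int[P]_(w in E) ((h (X k l w))%:E * (U k l w)%:E +
    (c k)%:E * \sum_(m < d) (U k m w)%:E))%E.
  by apply: eq_integral => w _; rewrite /U/= EFinD !EFinM sumEFin.
rewrite ge0_integralD//; last 4 first.
- by move=> w _; rewrite mule_ge0 ?lee_fin.
- apply: emeasurable_funM; last exact: mU.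
  by apply/measurable_funTS/measurable_EFinP; exact: mhX.
- by move=> w _; apply: mule_ge0; [|apply: sume_ge0 => m _]; rewrite lee_fin.
- by apply: measurable_funeM; apply: emeasurable_sum => m; exact: mU.
rewrite step ge0_integralZl_EFin//; last 2 first.
- by move=> w _; apply: sume_ge0 => m _; rewrite lee_fin.
- by apply: emeasurable_sum => m; exact: mU.
rewrite ge0_integral_sum//; last first.
  by move=> m w _; rewrite lee_fin.
under eq_bigr do rewrite ihE.
rewrite -ge0_sume_distrl; last by move=> m _; rewrite lee_fin.
by rewrite sumEFin muleA -!EFinM -muleDl.
Qed.

Lemma expectation_coupled_rec k l :
  (\int[P]_w (U k l w)%:E = (u k l)%:E)%E.
Proof.
(* The empty family of test events has the whole space as intersection. *)
have := @integral_coupled_rec k l [::] (fun=> setT).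
by rewrite big_nil probability_setT mule1; apply.
Qed.

End coupled_moments.

(** * Comparison, geometric decay and almost sure convergence *)

(** Comparison principle: nonnegative coefficients make the recursion monotone in its state. *)
Lemma coupled_rec_le (R : numDomainType) (d : nat) (b : nat -> 'I_d -> R)
    (c : nat -> R) (u0 : 'I_d -> R) (D : nat -> 'I_d -> R) :
  (forall k l, 0 <= b k l) -> (forall k, 0 <= c k) ->
  (forall l, D 0 l <= u0 l) ->
  (forall k l, D k.+1 l <= b k l * D k l + c k * \sum_(m < d) D k m) ->
  forall k l, D k l <= coupled_rec b c u0 k l.
Proof.
move=> b0 c0 D0 DS; elim=> //= k ih l.
by rewrite (le_trans (DS k l))// lerD ?ler_wpM2l ?ler_sum.
Qed.

(** Summation counts the coupling term once per coordinate, so the total obeys a scalar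
    recursion. *)
Lemma coupled_rec_sum_le (R : numDomainType) (d : nat) (b : nat -> 'I_d -> R)
    (c : nat -> R) (u0 : 'I_d -> R) (B : R) (k : nat) :
  (forall k l, 0 <= b k l <= B) -> (forall k, 0 <= c k) ->
  (forall l, 0 <= u0 l) ->
  \sum_(l < d) coupled_rec b c u0 k.+1 l <=
    (B + d%:R * c k) * \sum_(l < d) coupled_rec b c u0 k l.
Proof.
move=> bB c0 u00 /=; rewrite big_split/= sumr_const card_ord mulrDl.
rewrite -[d%:R * _ * _]mulrA mulr_natl lerD2r mulr_sumr ler_sum// => l _.
have b0 j m : 0 <= b j m by have /andP[] := bB j m.
by rewrite ler_wpM2r ?coupled_rec_ge0//; have /andP[] := bB k l.
Qed.

Lemma eventually_geometric (R : realType) (M a : nat -> R) (l r : R) :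
  (forall k, 0 <= M k) -> (forall k, M k.+1 <= a k * M k) ->
  a k @[k --> \oo] --> l -> l < r -> 0 <= r ->
  exists K, forall n, M (n + K)%N <= M K * r ^+ n.
Proof.
move=> M0 MS al lr r0.
have [K _ aK] : \forall k \near \oo, a k <= r by exact: cvgr_le lr.
exists K; elim=> [|n ih]; first by rewrite expr0 mulr1.
rewrite addSn (le_trans (MS _))// exprS mulrCA.
by rewrite (le_trans (ler_wpM2r (M0 _) (aK _ _)))/= ?leq_addl// ler_wpM2l.
Qed.

(** The integral of the sum of the [f n] is at most a convergent geometric series. The sum is
    therefore finite almost everywhere, and the terms of a convergent series tend to 0. *)
Lemma ae_cvg0_geometric_integral (disp : measure_display)
    (T : measurableType disp) (R : realType) (mu : {measure set T -> \bar R})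
    (f : nat -> T -> R) (C r : R) :
  (forall n, measurable_fun setT (f n)) -> (forall n w, 0 <= f n w) ->
  `|r| < 1 -> (forall n, (\int[mu]_w (f n w)%:E <= (C * r ^+ n)%:E)%E) ->
  {ae mu, forall w, f n w @[n --> \oo] --> (0 : R)}.
Proof.
move=> mf f0 r1 fC; pose F w := (\sum_(n <oo) (f n w)%:E)%E.
have mF : measurable_fun setT F.
  apply: ge0_emeasurable_sum => [n w _ _|n _]; first by rewrite lee_fin.
  exact/measurable_EFinP.
have F0 w : (0 <= F w)%E by apply: nneseries_ge0 => n _ _; rewrite lee_fin.
have F_lty : (\int[mu]_w F w < +oo)%E.
  rewrite integral_nneseries//; last 2 first.
  - by move=> n; exact/measurable_EFinP.
  - by move=> n w _; rewrite lee_fin.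
  apply: (@le_lt_trans _ _ (\sum_(n <oo) (C * r ^+ n)%:E)%E).
    apply: lee_nneseries => // n _ _.
    by apply: integral_ge0 => w _; rewrite lee_fin.
  have /cvg_ex[l Cl] := @is_cvg_geometric_series _ C _ r1.
  suff -> : (\sum_(n <oo) (C * r ^+ n)%:E = l%:E)%E by rewrite ltry.
  apply/cvg_lim => //.
  rewrite (_ : (fun n => _) = EFin \o series (geometric C r)).
    by apply: cvg_EFin => //; exact: nearW.
  by apply/funext => n; rewrite /= sumEFin.
have intF : mu.-integrable setT F.
  apply/integrableP; split => //.
  by under eq_integral do rewrite gee0_abs//.
apply: filterS (integrable_ae measurableT intF) => w /(_ Logic.I) Fw.
apply: cvg_series_cvg_0; apply: nnseries_is_cvg => //.
by rewrite -/(F w) -ge0_fin_numE.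
Qed.

(** * Pathwise bounds on particle differences *)

Section particle_distance.
Context {R : realType} {d N : nat}.
Implicit Types x y : 'cV[R]_d.

Lemma eucl_norm_sqr x : eucl_norm x ^+ 2 = \sum_(l < d) x l 0 ^+ 2.
Proof. by rewrite sqr_sqrtr// sumr_ge0// => l _; rewrite sqr_ge0. Qed.

(** Regrouped, the numerator compares [f] on the pair shifted along coordinate [l] and on the
    original pair. Both pairs differ by [x - y], whence the factor 2. *)
Lemma fd_grad_lipschitz (f : 'cV[R]_d -> R) (L sigma : R) x y (l : 'I_d) :
  eucl_lipschitz L f -> 0 < sigma ->
  `|fd_grad sigma f x l 0 - fd_grad sigma f y l 0| <=
    2 * L / sigma * eucl_norm (x - y).
Proof.
move=> fL s0; rewrite !mxE -mulrBl normrM.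
rewrite (gtr0_norm (_ : 0 < sigma^-1)) ?invr_gt0//.
rewrite mulrAC ler_pM2r ?invr_gt0//.
set e := sigma *: _.
rewrite (_ : _ - _ = (f (x + e) - f (y + e)) - (f x - f y)); last by ring.
rewrite (le_trans (ler_normB _ _))//.
have := fL (x + e) (y + e); rewrite opprD addrACA subrr addr0 => h.
by rewrite (le_trans (lerD h (fL x y)))// -mulrA [leRHS]mulr_natl mulr2n.
Qed.

Lemma escbo_diff_sqr_le (f : 'cV[R]_d -> R) (L beta lambda sigma : R)
    (alpha : nat -> R) (x0 : 'I_N -> 'cV[R]_d) (eta : nat -> 'cV[R]_d)
    (i j : 'I_N) (k : nat) (l : 'I_d) :
  eucl_lipschitz L f -> 0 < sigma ->
  (escbo f beta lambda sigma alpha x0 eta k i -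
   escbo f beta lambda sigma alpha x0 eta k j) l 0 ^+ 2 <=
  coupled_rec (fun k l => 2 * (1 - lambda - eta k l 0) ^+ 2)
    (fun k => 2 * (alpha k * (2 * L / sigma)) ^+ 2)
    (fun l => (x0 i - x0 j) l 0 ^+ 2) k l.
Proof.
move=> fL s0; set x := escbo _ _ _ _ _ _ _; move: k l.
apply: (@coupled_rec_le _ _ _ _ _ (fun k l => (x k i - x k j) l 0 ^+ 2)).
- by move=> k l; rewrite mulr_ge0// sqr_ge0.
- by move=> k; rewrite mulr_ge0// sqr_ge0.
- by [].
move=> k l; rewrite -eucl_norm_sqr.
(* Consensus point and noise are common to both particles, so only a coordinatewise multiplier and a
   gradient difference remain. *)
have -> : (x k.+1 i - x k.+1 j) l 0 =
    (1 - lambda - eta k l 0) * (x k i - x k j) l 0 -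
    alpha k * (fd_grad sigma f (x k i) l 0 - fd_grad sigma f (x k j) l 0).
  by rewrite /x/= /escbo_step !mxE; ring.
have /(_ s0) := @fd_grad_lipschitz f L sigma (x k i) (x k j) l fL.
set p := (1 - _ - _) * _; set g := fd_grad _ _ _ _ _ - _ => gL.
have : g ^+ 2 <= (2 * L / sigma * eucl_norm (x k i - x k j)) ^+ 2.
  by rewrite -real_normK ?num_real// lerXn2r ?nnegrE// (le_trans _ gL).
move=> {}gL.
apply: (@le_trans _ _ (2 * p ^+ 2 + 2 * alpha k ^+ 2 * g ^+ 2)).
  by have := sqr_ge0 (p + alpha k * g); lra.
apply: lerD; first by rewrite /p exprMn mulrA.
rewrite [leRHS](_ : _ = 2 * alpha k ^+ 2 *
  (2 * L / sigma * eucl_norm (x k i - x k j)) ^+ 2); last by ring.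
by rewrite ler_wpM2l// mulr_ge0// sqr_ge0.
Qed.

End particle_distance.

(** * Choice of the rate and almost sure consensus *)

Theorem theorem4p3 (R : realType) (d N : nat)
  (f : 'cV[R]_d -> R) (Lf : R)
  (f_ge0 : forall x, 0 <= f x)
  (Lf_gt0 : 0 < Lf) (f_lip : eucl_lipschitz Lf f)
  (beta lambda delta sigma : R) (alpha : nat -> R)
  (beta_gt0 : 0 < beta) (lambda_gt0 : 0 < lambda)
  (delta_ge0 : 0 <= delta) (sigma_gt0 : 0 < sigma)
  (alpha_ge0 : forall k, 0 <= alpha k)
  (x0 : 'I_N -> 'cV[R]_d)
  (disp : measure_display) (T : measurableType disp) (P : probability T R)
  (eta : nat -> 'I_d -> {RV P >-> R})
  (eta_noise : escbo_noise delta eta)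
  (x : nat -> 'I_N -> T -> 'cV[R]_d)
  (x_escbo : forall k i omega, x k i omega =
     escbo f beta lambda sigma alpha x0
       (fun k => \col_(l < d) eta k l omega) k i)
  (contraction_cond : (1 - lambda) ^+ 2 + delta ^+ 2 < 2^-1)
  (alpha_cvg0 : alpha k @[k --> \oo] --> (0 : R)) :
  exists tau2 : R, 0 < tau2 /\
    forall i j : 'I_N,
      {ae P, forall omega,
        expR (tau2 * k%:R) * eucl_norm (x k i omega - x k j omega) ^+ 2
          @[k --> \oo] --> (0 : R)}.
Proof.
have [eta_law _ eta_indep] := eta_noise.
set V := (1 - lambda) ^+ 2 + delta ^+ 2 in contraction_cond.
have V_ge0 : 0 <= V by rewrite addr_ge0 ?sqr_ge0.
(* The midpoint between [2 * V] and 1; [contraction_cond] says that [2 * V < 1]. *)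
pose rho := (2 * V + 1) / 2.
have rho_gt0 : 0 < rho by rewrite /rho; lra.
have V_rho : 2 * V < rho by rewrite /rho; lra.
have rho_lt1 : rho < 1 by rewrite /rho; lra.
(* Half of the decay rate of the expectations: one factor [expR (- tau)] per step pays for the
   exponential weight, the other keeps the series of expectations summable. *)
pose tau := - ln rho / 2.
have tau_gt0 : 0 < tau by rewrite divr_gt0// oppr_gt0 ln_lt0// rho_gt0.
have rhoE : rho = expR (- tau) ^+ 2.
  by rewrite -expRM_natl /tau mulNr opprK mulrC divfK// lnK.
exists tau; split=> // i j.
pose h y : R := 2 * (1 - lambda - y) ^+ 2.
have h_ge0 y : 0 <= h y by rewrite mulr_ge0// sqr_ge0.
have mh : measurable_fun setT h.
  apply: measurable_funM => //; apply: measurable_funX.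
  exact: measurable_funB.
(* The integral is finite by [h_le], so [fine] returns its true value. *)
pose v k l := fine (\int[P]_w (h (eta k l w))%:E)%E.
have h_le k l : (\int[P]_w (h (eta k l w))%:E <= (2 * V)%:E)%E.
  under eq_integral do rewrite EFinM.
  rewrite ge0_integralZl_EFin//; last 2 first.
  - by move=> w _; rewrite lee_fin sqr_ge0.
  - by apply/measurable_EFinP; apply: measurable_funX; exact: measurable_funB.
  rewrite EFinM lee_wpmul2l//.
  exact: normal_law_second_moment_le (eta_law k l).
have h_int_ge0 k l : (0 <= \int[P]_w (h (eta k l w))%:E)%E.
  by apply: integral_ge0 => w _; rewrite lee_fin.
have vE k l : (\int[P]_w (h (eta k l w))%:E)%E = (v k l)%:E.
  by rewrite fineK// ge0_fin_numE// (le_lt_trans (h_le k l))// ltry.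
have v_bnd k l : 0 <= v k l <= 2 * V.
  by rewrite -!lee_fin -vE h_int_ge0 h_le.
pose c k := 2 * (alpha k * (2 * Lf / sigma)) ^+ 2.
have c_ge0 k : 0 <= c k by rewrite mulr_ge0// sqr_ge0.
pose u0 l := (x0 i - x0 j) l 0 ^+ 2.
have u0_ge0 l : 0 <= u0 l by rewrite sqr_ge0.
pose U k l w := coupled_rec (fun j m => h (eta j m w)) c u0 k l.
have U_ge0 k l w : 0 <= U k l w by exact: coupled_rec_ge0.
have mU k l : measurable_fun setT (U k l) by exact: measurable_coupled_rec.
pose u := coupled_rec v c u0.
have u_ge0 k l : 0 <= u k l.
  by apply: coupled_rec_ge0 => // k' l'; have /andP[] := v_bnd k' l'.
have EU k l : (\int[P]_w (U k l w)%:E = (u k l)%:E)%E.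
  exact: expectation_coupled_rec.
have a_cvg : 2 * V + d%:R * c k @[k --> \oo] --> 2 * V.
  rewrite -[X in _ --> X]addr0; apply: cvgD; first exact: cvg_cst.
  rewrite -(mulr0 d%:R); apply: cvgMr => //.
  have -> : 0 = 2 * ((0 * (2 * Lf / sigma)) * (0 * (2 * Lf / sigma))) :> R.
    by rewrite mul0r !mulr0.
  by apply: cvgMr; apply: cvgM; apply: cvgMl.
have [K uK] := eventually_geometric (fun k => sumr_ge0 _ (fun l _ => u_ge0 k l))
  (fun k => coupled_rec_sum_le k v_bnd c_ge0 u0_ge0) a_cvg V_rho (ltW rho_gt0).
(* The time shift is there because the geometric bound [uK] starts at [K]; it does not affect the
   limit. *)
pose F n w := expR (tau * (n + K)%:R) * \sum_(l < d) U (n + K)%N l w.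
have F_cvg : {ae P, forall w, F n w @[n --> \oo] --> (0 : R)}.
  apply: (@ae_cvg0_geometric_integral _ _ _ _ F
    (expR (tau * K%:R) * \sum_(l < d) u K l) (expR (- tau))).
  - move=> n; apply: measurable_funM => //.
    by apply: measurable_sum => l; exact: mU.
  - by move=> n w; rewrite mulr_ge0 ?expR_ge0// sumr_ge0.
  - by rewrite ger0_norm ?expR_ge0// expR_lt1 oppr_lt0.
  move=> n; under eq_integral do rewrite EFinM -sumEFin.
  rewrite ge0_integralZl_EFin ?expR_ge0//; last 2 first.
  - by move=> w _; apply: sume_ge0 => l _; rewrite lee_fin.
  - by apply: emeasurable_sum => l; exact/measurable_EFinP.
  rewrite ge0_integral_sum//; last 2 first.
  - by move=> l; exact/measurable_EFinP.
  - by move=> l w _; rewrite lee_fin.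
  under eq_bigr do rewrite EU.
  rewrite sumEFin -EFinM lee_fin.
  apply: (le_trans (ler_wpM2l (expR_ge0 _) (uK n))).
  have tauK : expR (tau * n%:R) * expR (- tau) ^+ n = 1.
    by rewrite -expRM_natr -expRD mulNr subrr expR0.
  rewrite natrD mulrDr expRD rhoE expr2 exprMn.
  rewrite [leLHS](_ : _ = expR (tau * n%:R) * expR (- tau) ^+ n *
    (expR (tau * K%:R) * (\sum_(l < d) u K l) * expR (- tau) ^+ n));
    last by ring.
  by rewrite tauK mul1r.
apply: filterS F_cvg => w Fw.
(* Along a path where [F] tends to 0, the weighted squared distance lies between 0 and [F]. *)
rewrite -(cvg_shiftn K); apply: (squeeze_cvgr _ (cvg_cst 0) Fw).
apply: nearW => n; rewrite mulr_ge0 ?expR_ge0 ?sqr_ge0//=.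
rewrite ler_wpM2l ?expR_ge0// eucl_norm_sqr ler_sum// => l _.
rewrite !x_escbo.
rewrite (le_trans (escbo_diff_sqr_le _ _ _ _ _ _ _ _ _ f_lip sigma_gt0))//.
rewrite /U /h le_eqVlt; apply/orP; left; apply/eqP.
congr (coupled_rec _ _ _ _ _).
by apply/funext => k; apply/funext => m; rewrite mxE.
Qed.
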